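(* Let $(a_j)_{j\ge1},(b_j)_{j\ge1}$ be Cao's real sequences and let $(\alpha_j)_{j\ge1},(\beta_j)_{j\ge1}$ be the sequences attached to $\mu_k=B_{k+1}/(k+1)$, both defined in the context. Then for every integer $j\ge1$, $$a_j=\alpha_j\qquad\text{and}\qquad b_j=\beta_j .$$ In particular, for all integers $1\le j\le k$, the denominator tails $U_j(n)$ and $V_j(n)$ (of the $k$-th approximants, defined in the context) satisfy $$U_j(n)-nV_j(n)=O\!\left(n^{-(2k-2j+1)}\right)\quad\text{as } n\to\infty .$$
   Context: Bernoulli numbers $B_k$ are defined by $\frac{t}{e^t-1}=\sum_{k\ge0}B_k\frac{t^k}{k!}$ (so $B_1=-1/2$), and $\mu_k:=\frac{B_{k+1}}{k+1}$ for $k\ge0$. Sequences $\alpha_j,\beta_j$: Let $L$ be the linear functional on real polynomials with $L(y^k)=\mu_k$. Since $\det(\mu_{i+j})_{0\le i,j\le n}\ne0$ for all $n\geq 0$, there is a unique sequence of monic polynomials $R_n(y)$, $\deg R_n=n$, with $L(R_mR_n)=0$ for $m\ne n$ and $L(R_n^2)\neq0$. They satisfy $R_0(y)=1$, $R_1(y)=y+\beta_1$ and $R_{n+1}(y)=(y+\beta_{n+1})R_n(y)+\alpha_{n+1}R_{n-1}(y)$ for $n\ge1$; this defines $\beta_j$ for $j\ge1$ and $\alpha_j$ for $j\ge2$. Put $\alpha_1:=-\mu_0=\frac12$. Sequences $a_j,b_j$ (Cao): these are the real sequences such that, writing $H_n=\sum_{i=1}^n 1/i$, $\gamma$ for the Euler--Mascheroni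 constant, $$MC_k(n)=\cfrac{a_1}{n+b_1+\cfrac{a_2}{n+b_2+\ddots+\cfrac{a_k}{n+b_k}}},\qquad E_k(n):=H_n-\log n-\gamma-MC_k(n),$$ for every $k\ge1$ there is a constant $C_k$ with $\lim_{n\to\infty}n^{2k+1}E_k(n)=C_k$ and $\lim_{n\to\infty}n^{2k+2}\left(E_k(n)-E_k(n+1)\right)=(2k+1)C_k$. In particular, $E_k(n)=O(n^{-2k-1})$ for every $k$. The first values are $a_1=\frac12$, $b_1=\frac16$, $a_2=\frac1{36}$, $b_2=\frac{13}{30}$, $a_3=\frac{9}{25}$, $b_3=\frac{17}{630}$. Denominator tails: for fixed $k\ge1$ and $n$ a sufficiently large positive integer, define $U_k(n)=n+b_k$, $V_k(n)=1+\frac{\beta_k}{n}$, and for $1\le j\le k-1$, $$U_j(n)=n+b_j+\frac{a_{j+1}}{U_{j+1}(n)},\qquad V_j(n)=1+\frac{\beta_j}{n}+\frac{\alpha_{j+1}}{n^2V_{j+1}(n)}.$$ *)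

(* Defs.v *)
From mathcomp Require Export all_boot all_order all_algebra.
From mathcomp Require Export all_classical all_reals all_analysis.

Set Implicit Arguments.
Unset Strict Implicit.
Unset Printing Implicit Defensive.

Export Order.TTheory GRing.Theory Num.Theory.
Export numFieldNormedType.Exports.

Local Open Scope classical_set_scope.
Local Open Scope ring_scope.

(* The point t = 0 is a removable singularity of t / (e^t - 1), hence the
   punctured neighbourhood. *)
Definition bernoulli_numbers (R : realType) (B : nat -> R) : Prop :=
  \forall t \near 0^',
    [series B k * t ^+ k / k`!%:R]_k @ \oo --> t / (expR t - 1).

Definition bernoulli_moment (R : realType) (B : nat -> R) (k : nat) : R :=
  B k.+1 / k.+1%:R.

Definition moment_functional (R : realType) (mu : nat -> R) (p : {poly R}) : R :=
  \sum_(i < size p) p`_i * mu i.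

Definition monic_orthogonal (R : realType) (mu : nat -> R)
    (P : nat -> {poly R}) : Prop :=
  [/\ forall n, P n \is monic /\ size (P n) = n.+1,
      forall m n, m <> n -> moment_functional mu (P m * P n) = 0
    & forall n, moment_functional mu (P n ^+ 2) != 0].

(* Here and below, sequences indexed from 1 are functions on nat whose value
   at 0 is irrelevant. *)
Definition recurrence_coefficients (R : realType) (mu : nat -> R)
    (alpha beta : nat -> R) : Prop :=
  alpha 1%N = - mu 0%N /\
  exists P : nat -> {poly R},
    [/\ monic_orthogonal mu P,
        P 0%N = 1,
        P 1%N = 'X + (beta 1%N)%:P
      & forall n, (1 <= n)%N ->
          P n.+1 = ('X + (beta n.+1)%:P) * P n + alpha n.+1 *: P n.-1].

Definition harmonic_number (R : realType) (n : nat) : R :=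
  \sum_(1 <= i < n.+1) i%:R^-1.

Definition euler_gamma (R : realType) : R :=
  lim ((fun n : nat => harmonic_number R n - ln n%:R) @ \oo).

(* [U_tail a b x d j] and [V_tail alpha beta x d j] are the tails with index j
   having d further levels below them, i.e. the j-th tails of the (j + d)-th
   approximants, at x = n.  Division is total with x / 0 = 0; for fixed d and j
   no denominator vanishes once x is large, so only large n is meaningful. *)
Fixpoint U_tail (R : realType) (a b : nat -> R) (x : R) (d j : nat) : R :=
  if d is d'.+1 then x + b j + a j.+1 / U_tail a b x d' j.+1 else x + b j.

Fixpoint V_tail (R : realType) (alpha beta : nat -> R) (x : R) (d j : nat) : R :=
  if d is d'.+1 then
    1 + beta j / x + alpha j.+1 / (x ^+ 2 * V_tail alpha beta x d' j.+1)
  else 1 + beta j / x.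

Definition U_den (R : realType) (a b : nat -> R) (k j n : nat) : R :=
  U_tail a b n%:R (k - j) j.

Definition V_den (R : realType) (alpha beta : nat -> R) (k j n : nat) : R :=
  V_tail alpha beta n%:R (k - j) j.

(* Meaningful for 1 <= k. *)
Definition MC (R : realType) (a b : nat -> R) (k n : nat) : R :=
  a 1%N / U_den a b k 1 n.

Definition approx_error (R : realType) (a b : nat -> R) (k n : nat) : R :=
  harmonic_number R n - ln n%:R - euler_gamma R - MC a b k n.

Definition cao_sequences (R : realType) (a b : nat -> R) : Prop :=
  forall k, (1 <= k)%N -> exists C : R,
    (fun n : nat => n%:R ^+ (2 * k + 1) * approx_error a b k n) @ \oo --> C /\
    (fun n : nat => n%:R ^+ (2 * k + 2) *
       (approx_error a b k n - approx_error a b k n.+1)) @ \oo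
      --> (2 * k + 1)%:R * C.

(* Main.v *)
From mathcomp Require Import ring lra.
Require Import Defs.

(* Put [f n = H_n - ln n - gamma].  Since [f n - f n.+1 = ln (1 + 1/n) - 1/(n+1)]
   and [f] tends to 0, telescoping gives the asymptotic expansion of [f] in powers
   of [1/n], with coefficients the negated moments [- mu_k]; only the identity
   [sum_(k < m) (-1)^k C(m,k) mu_k = - m / (m+1)] is needed.  Clearing denominators,
   Cao's condition says that the denominator [Q_k] of the k-th approximant satisfies
   [Q_k f - P_k = O(n^-(k+1))], and comparing coefficients [Q_k] is orthogonal to all
   polynomials of degree less than k.  Hence [Q_k] is the k-th monic orthogonal
   polynomial, and both satisfy a three-term recurrence, whose coefficients agree.
   The tails then satisfy [U_j = n V_j] exactly. *)

Set Implicit Arguments.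
Unset Strict Implicit.
Unset Printing Implicit Defensive.

Local Open Scope classical_set_scope.
Local Open Scope ring_scope.

(** * Expansions in powers of 1/n *)

Definition decays (R : realType) (N : nat) (f : nat -> R) : Prop :=
  exists C : R, \forall n \near \oo, `|f n| <= C * n%:R^-1 ^+ N.

(** Only the coefficients of [p] below [N] are determined, so products and sums need no
    truncation. *)
Definition expands (R : realType) (N : nat) (f : nat -> R) (p : {poly R}) : Prop :=
  decays N (fun n => f n - p.[n%:R^-1]).

Lemma decays_eq (R : realType) N (f g : nat -> R) :
  (\forall n \near \oo, f n = g n) -> decays N f -> decays N g.
Proof.
move=> fg [C Cf]; exists C; near=> n.
have <- : f n = g n by near: n.
by near: n.
Unshelve. all: by end_near. Qed.

Lemma decaysD (R : realType) N (f g : nat -> R) :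
  decays N f -> decays N g -> decays N (fun n => f n + g n).
Proof.
move=> [C Cf] [D Dg]; exists (C + D); near=> n.
rewrite mulrDl (le_trans (ler_normD _ _))// lerD//; near: n; [exact: Cf|exact: Dg].
Unshelve. all: by end_near. Qed.

Lemma decaysM (R : realType) N M (f g : nat -> R) :
  decays N f -> decays M g -> decays (N + M) (fun n => f n * g n).
Proof.
move=> [C Cf] [D Dg]; exists (C * D); near=> n.
rewrite exprD mulrACA normrM ler_pM//; near: n; [exact: Cf|exact: Dg].
Unshelve. all: by end_near. Qed.

Lemma decaysN (R : realType) N (f : nat -> R) :
  decays N f -> decays N (fun n => - f n).
Proof. by move=> [C Cf]; exists C; under eq_near do rewrite normrN. Qed.

Lemma decays_leq (R : realType) M N (f : nat -> R) :
  (M <= N)%N -> decays N f -> decays M f.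
Proof.
move=> MN [C Cf]; exists `|C|; near=> n.
have n0 : (0 < n)%N by near: n; exact: nbhs_infty_gt.
have : `|f n| <= C * n%:R^-1 ^+ N by near: n.
move=> /le_trans; apply; apply: (@le_trans _ _ (`|C| * n%:R^-1 ^+ N)).
  by rewrite ler_wpM2r ?exprn_ge0// ler_norm.
rewrite ler_wpM2l// ler_wiXn2l// invf_le1 ?ler1n ?ltr0n//.
Unshelve. all: by end_near. Qed.

Lemma decays_pow (R : realType) N : @decays R N (fun n => n%:R^-1 ^+ N).
Proof.
by exists 1; near=> n; rewrite mul1r ger0_norm// exprn_ge0.
Unshelve. all: by end_near. Qed.

Lemma decays_cst (R : realType) (c : R) : decays 0 (fun=> c).
Proof. by exists `|c|; near=> n; rewrite expr0 mulr1.
Unshelve. all: by end_near. Qed.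

Lemma decays0 (R : realType) N : @decays R N (fun=> 0).
Proof. by exists 0; near=> n; rewrite mul0r normr0.
Unshelve. all: by end_near. Qed.

Lemma decays_poly (R : realType) (p : {poly R}) :
  decays 0 (fun n => p.[n%:R^-1]).
Proof.
elim/poly_ind: p => [|p c IH].
  by apply: decays_eq (decays0 R 0); near=> n; rewrite horner0.
apply: (decays_eq (f := fun n => p.[n%:R^-1] * n%:R^-1 ^+ 1 + c)).
  by near=> n; rewrite hornerMXaddC expr1.
apply: decaysD (decays_cst c); apply: decays_leq (decaysM IH (decays_pow R 1)).
by [].
Unshelve. all: by end_near. Qed.

Lemma decays_cvg0 (R : realType) N (f : nat -> R) :
  decays N.+1 f -> f @ \oo --> (0 : R).
Proof.
move=> /(decays_leq (ltn0Sn N))[C Cf].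
apply/cvgr0Pnorm_le => e e0; near=> n.
have n0 : 0 < n%:R :> R by rewrite ltr0n; near: n; exact: nbhs_infty_gt.
have : `|f n| <= C * n%:R^-1 ^+ 1 by near: n.
move=> /le_trans; apply; rewrite expr1 ler_pdivrMr// mulrC -ler_pdivrMr//.
by near: n; exact: nbhs_infty_ger.
Unshelve. all: by end_near. Qed.

(** The constant coefficient is the limit at infinity, hence 0; dividing by [1/n] lowers both the
    degree and [N]. *)
Lemma expands_coef0 (R : realType) N (p : {poly R}) :
  decays N (fun n => p.[n%:R^-1]) -> forall i, (i < N)%N -> p`_i = 0.
Proof.
elim: N p => [//|N IH]; elim/poly_ind => [|p c _] dp i iN; first by rewrite coef0.
have c0 : c = 0.
  have dc : decays 1 (fun=> c).
    apply: (decays_eq (f := fun n => (p * 'X + c%:P).[n%:R^-1]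
                                     - p.[n%:R^-1] * n%:R^-1 ^+ 1)).
      by near=> n; rewrite hornerMXaddC expr1 addrAC subrr add0r.
    apply: decaysD; first exact: decays_leq dp.
    apply: decaysN; apply: decays_leq (decaysM (decays_poly p) (decays_pow R 1)).
    by [].
  have := decays_cvg0 dc; move=> /(cvg_unique _ (cvg_cst c)) -> //.
subst c; rewrite addr0 in dp *.
rewrite coefMX; case: i iN => [//|i] /= iN; apply: IH iN.
case: dp => C dp; exists C; near=> n.
have n0 : 0 < n%:R^-1 :> R.
  by rewrite invr_gt0 ltr0n; near: n; exact: nbhs_infty_gt.
rewrite -(ler_pM2r n0) -mulrA -exprSr.
have <- : `|(p * 'X).[n%:R^-1]| = `|p.[n%:R^-1]| * n%:R^-1.
  by rewrite hornerMX normrM (gtr0_norm n0).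
by near: n.
Unshelve. all: by end_near. Qed.

Lemma poly_decays (R : realType) N (p : {poly R}) :
  (forall i, (i < N)%N -> p`_i = 0) -> decays N (fun n => p.[n%:R^-1]).
Proof.
elim: N p => [|N IH] p; first by move=> _; exact: decays_poly.
elim/poly_ind: p => [|p c _] p0.
  by apply: decays_eq (decays0 R _); near=> n; rewrite horner0.
have := p0 0%N isT; rewrite coefD coefMX coefC/= add0r => c0; subst c.
apply: (decays_eq (f := fun n => p.[n%:R^-1] * n%:R^-1 ^+ 1)).
  by near=> n; rewrite addr0 hornerMX expr1.
rewrite -addn1; apply: decaysM (decays_pow R 1); apply: IH => i iN.
by have := p0 i.+1 iN; rewrite addr0 coefMX.
Unshelve. all: by end_near. Qed.

Lemma expands_poly (R : realType) N (p q : {poly R}) :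
  (forall i, (i < N)%N -> p`_i = q`_i) -> expands N (fun n => p.[n%:R^-1]) q.
Proof.
move=> pq; apply: (decays_eq (f := fun n => (p - q).[n%:R^-1])).
  by near=> n; rewrite hornerD hornerN.
by apply: poly_decays => i iN; rewrite coefB pq// subrr.
Unshelve. all: by end_near. Qed.

Lemma expands_uniq (R : realType) N f (p q : {poly R}) :
  expands N f p -> expands N f q -> forall i, (i < N)%N -> p`_i = q`_i.
Proof.
move=> fp fq i iN; apply/eqP; rewrite -subr_eq0 -coefB; apply/eqP.
apply: expands_coef0 iN; apply: decays_eq (decaysD fq (decaysN fp)).
by near=> n; rewrite hornerD hornerN; ring.
Unshelve. all: by end_near. Qed.

Lemma expandsD (R : realType) N f g (p q : {poly R}) :
  expands N f p -> expands N g q -> expands N (fun n => f n + g n) (p + q).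
Proof.
move=> fp gq; apply: decays_eq (decaysD fp gq).
by near=> n; rewrite hornerD; ring.
Unshelve. all: by end_near. Qed.

Lemma expandsN (R : realType) N f (p : {poly R}) :
  expands N f p -> expands N (fun n => - f n) (- p).
Proof.
move=> fp; apply: decays_eq (decaysN fp).
by near=> n; rewrite hornerN; ring.
Unshelve. all: by end_near. Qed.

(** Uses [f g - p q = f (g - q) + (f - p) q], where [f] is bounded because [p] is. *)
Lemma expandsM (R : realType) N f g (p q : {poly R}) :
  expands N f p -> expands N g q -> expands N (fun n => f n * g n) (p * q).
Proof.
move=> fp gq.
have d0 : decays 0 f.
  apply: (decays_eq (f := fun n => (f n - p.[n%:R^-1]) + p.[n%:R^-1])).
    by near=> n; ring.
  by apply: decaysD (decays_poly p); exact: decays_leq fp.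
have := decaysM fp (decays_poly q); rewrite addn0 => fpq.
apply: decays_eq (decaysD (decaysM d0 gq) fpq).
by near=> n; rewrite hornerM; ring.
Unshelve. all: by end_near. Qed.

Lemma expands_eq (R : realType) N (f g : nat -> R) p :
  (\forall n \near \oo, f n = g n) -> expands N f p -> expands N g p.
Proof.
move=> fg; rewrite /expands => fp; apply: decays_eq fp; near=> n.
by have -> : f n = g n by near: n.
Unshelve. all: by end_near. Qed.

(** The differences of [d] are dominated by those of a multiple of [n^-(N+1)]; summing up to
    infinity, where [d] vanishes, costs one order. *)
Lemma decays_telescope (R : realType) N (d : nat -> R) :
  decays N.+2 (fun n => d n - d n.+1) -> d @ \oo --> (0 : R) -> decays N.+1 d.
Proof.
move=> [C [M _ dC]] d0; exists (2 * `|C|).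
(* With [u = 1/n] and [v = 1/(n+1)], [u^(N+1) - v^(N+1) >= (u - v) u^N] and [u - v >= u^2 / 2]; the
   factor 2 compensates the last half. *)
pose h (n : nat) : R := 2 * `|C| * n%:R^-1 ^+ N.+1.
have step n : (M <= n)%N -> (0 < n)%N -> `|d n - d n.+1| <= h n - h n.+1.
  move=> Mn n0; have := dC n Mn => /= /le_trans; apply.
  have n0R : 0 < n%:R :> R by rewrite ltr0n.
  have n1R : 1 <= n%:R :> R by rewrite ler1n.
  have Cle : C <= `|C| by exact: ler_norm.
  have u0 : 0 < n%:R^-1 :> R by rewrite invr_gt0.
  have v0 : 0 < n.+1%:R^-1 :> R by rewrite invr_gt0 ltr0n.
  have vu : n.+1%:R^-1 <= n%:R^-1 :> R.
    by rewrite lef_pV2 ?posrE ?ltr0n// ler_nat.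
  have uv : n%:R^-1 - n.+1%:R^-1 >= n%:R^-1 ^+ 2 / 2 :> R.
    rewrite -[n.+1%:R]natr1.
    have -> : n%:R^-1 - (n%:R + 1)^-1 = n%:R^-1 ^+ 2 * (n%:R / (n%:R + 1)) :> R.
      by field; rewrite gt_eqF// gt_eqF// ltr_wpDl.
    rewrite ler_wpM2l ?exprn_ge0//.
    by rewrite ler_pdivlMr ?addr_gt0// mulrC ler_pdivrMr//; lra.
  have vuN : n.+1%:R^-1 ^+ N <= n%:R^-1 ^+ N :> R.
    by rewrite lerXn2r// nnegrE ltW.
  apply: (@le_trans _ _ (`|C| * n%:R^-1 ^+ N.+2)).
    by rewrite ler_wpM2r// exprn_ge0// ltW.
  have -> : h n - h n.+1 = `|C| * (2 * (n%:R^-1 ^+ N.+1 - n.+1%:R^-1 ^+ N.+1)).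
    by rewrite /h; ring.
  rewrite ler_wpM2l// -addn2 exprD.
  apply: (@le_trans _ _ (2 * ((n%:R^-1 - n.+1%:R^-1) * n%:R^-1 ^+ N))).
    rewrite [leLHS](_ : _ = 2 * (n%:R^-1 ^+ 2 / 2 * n%:R^-1 ^+ N)); last by field; rewrite gt_eqF.
    by rewrite ler_wpM2l// ler_wpM2r// exprn_ge0.
  rewrite ler_wpM2l// !exprS mulrBl lerD2l lerN2 ler_wpM2l// ltW//.
near=> n.
have Mn : (M <= n)%N by near: n; exact: nbhs_infty_ge.
have n0 : (0 < n)%N by near: n; exact: nbhs_infty_gt.
have h0 m : 0 <= h m by rewrite /h mulr_ge0// exprn_ge0.
have steps m : `|d n - d (n + m)%N| <= h n - h (n + m)%N.
  elim: m => [|m IH]; first by rewrite addn0 !subrr normr0.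
  rewrite (_ : d n - _ = d n - d (n + m)%N + (d (n + m)%N - d (n + m).+1)).
    apply: le_trans (ler_normD _ _) _.
    have := step (n + m)%N (leq_trans Mn (leq_addr _ _)) (ltn_addr _ n0).
    by rewrite addnS; lra.
  by rewrite addnS; ring.
(* Passage to the limit: at distance [K] the value of [d] is at most [e], and [h (n + K)] is dropped
   since it is nonnegative. *)
rewrite -/(h n); apply/ler_addgt0Pr => e e0.
have [K _ dK] : \forall m \near \oo, `|d m| <= e by exact: cvgr0_norm_le.
have := dK (n + K)%N (leq_addl _ _) => /= dKe.
have := ler_normD (d n - d (n + K)%N) (d (n + K)%N); rewrite subrK.
have := steps K; have := h0 (n + K)%N; lra.
Unshelve. all: by end_near. Qed.

(** * Power series as expansions in powers of 1/n *)

Lemma geometric_sum_le2 (R : realType) (r : R) m :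
  0 <= r <= 2^-1 -> \sum_(i < m) r ^+ i <= 2.
Proof.
move=> /andP[r0 r2]; elim: m => [|m IH]; first by rewrite big_ord0.
rewrite big_ord_recl expr0.
under eq_bigr do rewrite exprS.
rewrite -mulr_sumr.
have : r * \sum_(i < m) r ^+ i <= 2^-1 * 2 by rewrite ler_pM// sumr_ge0// => i _; rewrite exprn_ge0.
by rewrite mulVf//; lra.
Qed.

(** The terms at [t0] are bounded by some [M], so for [|t| <= t0 / 2] the tail is dominated by a
    geometric series of ratio at most 1/2. The constant does not depend on [t]. *)
Lemma power_series_remainder (R : realType) (c : nat -> R) (t0 : R) N :
  0 < t0 -> cvgn (series (fun k => c k * t0 ^+ k)) ->
  exists C : R, forall t l : R, `|t| <= t0 / 2 ->
    series (fun k => c k * t ^+ k) @ \oo --> l ->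
    `|l - (\poly_(k < N) c k).[t]| <= C * `|t| ^+ N.
Proof.
move=> t00 /cvg_series_cvg_0 c0.
have [M [M0 cM]] : exists M, 0 <= M /\ forall k, `|c k| * t0 ^+ k <= M.
  have /cvg_seq_bounded[M [_ bM]] : cvgn (fun k => c k * t0 ^+ k).
    by apply/cvg_ex; exists 0.
  exists (`|M| + 1); split => [|k]; first by rewrite addr_ge0.
  rewrite -[t0]gtr0_norm// -normrX -normrM; apply: bM => //.
  by rewrite (le_lt_trans (ler_norm _))// ltrDl.
exists (2 * M * t0 ^- N) => t l tt0 cl.
have r02 : 0 <= `|t| / t0 <= 2^-1.
  by rewrite divr_ge0 ?(ltW t00)// ler_pdivrMr// mulrC.
rewrite horner_poly; apply/ler_addgt0Pr => e e0.
have [K _ lK] : \forall m \near \oo, `|l - series (fun k => c k * t ^+ k) m| <= e.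
  by move/cvgrPdist_le : cl; apply.
have := lK (N + K)%N (leq_addl _ _) => /= {}lK.
rewrite -(subrK (series (fun k => c k * t ^+ k) (N + K)%N) l) -addrA.
apply: le_trans (ler_normD _ _) _; rewrite [leLHS]addrC lerD//.
rewrite /series/= big_mkord big_split_ord/= addrAC subrr add0r.
apply: le_trans (ler_norm_sum _ _ _) _.
apply: (@le_trans _ _ (\sum_(i < K) (M * (`|t| / t0) ^+ N * (`|t| / t0) ^+ i))).
  apply: ler_sum => i _; rewrite -mulrA -exprD normrM normrX expr_div_n mulrA.
  rewrite ler_pdivlMr ?exprn_gt0// mulrAC ler_wpM2r ?exprn_ge0//.
rewrite -mulr_sumr [leRHS](_ : _ = M * (`|t| / t0) ^+ N * 2).
  by rewrite ler_wpM2l ?geometric_sum_le2// mulr_ge0// exprn_ge0//; case/andP: r02.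
by rewrite expr_div_n; ring.
Qed.

(** The scale [s] allows evaluation at [1/n] and at [-1/n]. As [s / n] is nonzero for large [n], a
    punctured neighbourhood suffices. *)
Lemma expands_power_series (R : realType) (c : nat -> R) (F : R -> R) (s : R) N :
  s != 0 ->
  (\forall t \near 0^', series (fun k => c k * t ^+ k) @ \oo --> F t) ->
  expands N (fun n => F (s * n%:R^-1)) (\poly_(k < N) (s ^+ k * c k)).
Proof.
move=> s0 [e /= e0 cF].
have cFt t : t != 0 -> `|t| < e -> series (fun k => c k * t ^+ k) @ \oo --> F t.
  by move=> t0 te; apply: cF => //=; rewrite sub0r normrN.
have t00 : 0 < e / 2 by rewrite divr_gt0.
have [|C HC] := @power_series_remainder _ c (e / 2) N t00.
  apply/cvg_ex; exists (F (e / 2)); apply: cFt; first by rewrite gt_eqF.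
  by rewrite gtr0_norm// ltr_pdivrMr// ltr_pMr// ltr1n.
exists (C * `|s| ^+ N); near=> n.
have n0 : 0 < n%:R :> R by rewrite ltr0n; near: n; exact: nbhs_infty_gt.
have nz : s * n%:R^-1 != 0 by rewrite mulf_neq0// invr_eq0 gt_eqF.
have nE : `|s * n%:R^-1| = `|s| * n%:R^-1.
  by rewrite normrM [X in _ * X]gtr0_norm// invr_gt0.
have small : `|s * n%:R^-1| <= e / 2 / 2.
  rewrite nE ler_pdivrMr// -ler_pdivrMl ?divr_gt0//.
  by near: n; exact: nbhs_infty_ger.
have lt_e : `|s * n%:R^-1| < e.
  apply: le_lt_trans small _.
  by rewrite ltr_pdivrMr// ltr_pdivrMr// -mulrA ltr_pMr//; lra.
have := HC (s * n%:R^-1) (F (s * n%:R^-1)) small (cFt _ nz lt_e).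
rewrite nE exprMn mulrA !horner_poly.
rewrite (eq_bigr (fun i : 'I_N => s ^+ i * c i * n%:R^-1 ^+ i)); last first.
  by move=> i _; rewrite exprMn; ring.
by [].
Unshelve. all: by end_near. Qed.

Lemma expR_series_near (R : realType) :
  \forall t \near 0^', series (fun k => k`!%:R^-1 * t ^+ k) @ \oo --> expR (t : R).
Proof.
near=> t.
rewrite (_ : series _ = series (exp_coeff t)); first exact: is_cvg_series_exp_coeff.
by congr series; apply/funext => k; rewrite /exp_coeff/= mulrC.
Unshelve. all: by end_near. Qed.

(** * Bernoulli numbers and the harmonic numbers *)

(* Compares coefficients in [B(-u) (exp u - 1) = u exp u], where
   [B(t) = t / (exp t - 1)]. *)
Lemma bernoulli_sum (R : realType) (B : nat -> R) m :
  bernoulli_numbers B ->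
  \sum_(i < m.+1) (-1) ^+ i * 'C(m.+1, i)%:R * B i = m.+1%:R.
Proof.
(* The coefficient of index [m.+1] is the one compared, hence order [m.+2]. *)
move=> hB; pose N := m.+2.
pose E : {poly R} := \poly_(k < N) (1 ^+ k * k`!%:R^-1).
pose P : {poly R} := \poly_(k < N) ((-1) ^+ k * (B k / k`!%:R)).
have hE : expands N (fun n => expR (1 * n%:R^-1)) E.
  exact: expands_power_series (oner_neq0 _) (expR_series_near R).
have hP : expands N (fun n => -1 * n%:R^-1 / (expR (-1 * n%:R^-1) - 1)) P.
  apply: (@expands_power_series _ _ (fun t => t / (expR t - 1))).
    by rewrite oppr_eq0 oner_neq0.
  apply: filterS hB => t; rewrite (_ : (fun k => _) = fun k => B k * t ^+ k / k`!%:R)//.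
  by apply/funext => k; rewrite mulrAC.
have hu : expands N (fun n => n%:R^-1 : R) 'X.
  by apply: decays_eq (decays0 R N); near=> n; rewrite hornerX subrr.
have h1 : expands N (fun=> -1 : R) (- 1).
  by apply: decays_eq (decays0 R N); near=> n; rewrite hornerN hornerC subrr.
have EP := expandsM hP (expandsD hE h1); have XE := expandsM hu hE.
have {}EP : expands N (fun n => n%:R^-1 * expR (1 * n%:R^-1)) (P * (E + - 1)).
  apply: expands_eq EP; near=> n.
  have n0 : 0 < n%:R^-1 :> R by rewrite invr_gt0 ltr0n; near: n; exact: nbhs_infty_gt.
  rewrite mulN1r mul1r expRN.
  have x1 : expR n%:R^-1 - 1 != 0 :> R by rewrite subr_eq0 gt_eqF// expR_gt1.
  field; rewrite -invr_eq0 gt_eqF//= gt_eqF ?expR_gt0//=.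
  by rewrite mulN1r -opprB oppr_eq0.
have := expands_uniq EP XE (ltnSn m.+1).
have Ek k : (k < N)%N -> E`_k = k`!%:R^-1.
  by move=> kN; rewrite coef_poly kN expr1n mul1r.
rewrite coefXM/= coefM big_ord_recr/= subnn coefB coef1 !Ek// fact0 invr1.
rewrite subrr mulr0 addr0.
(* Multiplication by [(m+1)!] turns [1 / (i! (m+1-i)!)] into a binomial coefficient. *)
move=> /(congr1 (fun x => m.+1`!%:R * x)); rewrite mulr_sumr => h.
have fact0R k : k`!%:R != 0 :> R by rewrite pnatr_eq0 -lt0n fact_gt0.
transitivity (m.+1`!%:R * (m`!%:R^-1) : R); last first.
  by rewrite factS natrM mulfK.
rewrite -h; apply: eq_bigr => i _; have im := ltn_ord i.
rewrite coefB coef1 Ek ?ltnS ?leq_subr// subn_eq0 leqNgt im subr0.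
rewrite coef_poly ltnS (ltnW im).
rewrite -(bin_fact (ltnW im)) !natrM; field.
by rewrite !fact0R.
Unshelve. all: by end_near. Qed.

(* The constant coefficient is [1 / 0 = 0]. *)
Lemma ln_remainder (R : realType) (t : R) N : 0 <= t ->
  `|ln (1 + t) - (\poly_(i < N.+1) ((-1) ^+ i.-1 / i%:R)).[t]| <= t ^+ N.+1.
Proof.
move=> t0; pose p : {poly R} := \poly_(i < N.+1) ((-1) ^+ i.-1 / i%:R).
(* The derivative of [p] is a truncated geometric series for [1 / (1 + c)], so the derivative of the
   remainder is exactly [(-c)^N / (1 + c)]. *)
have dp c : (1 + c) * p^`().[c] = 1 - (- c) ^+ N.
  have -> : p^`() = \poly_(i < N) (-1) ^+ i.
    apply/polyP => i; rewrite coef_deriv !coef_poly ltnS; case: ifP => _; last by rewrite mul0rn.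
    by rewrite -[_ *+ _]mulr_natr mulfVK// pnatr_eq0.
  have -> : 1 - (- c) ^+ N = (1 + c) * \sum_(i < N) (- c) ^+ i.
    by rewrite -[LHS]opprB subrX1; ring.
  by rewrite horner_poly; congr (_ * _); apply: eq_bigr => i _; rewrite -exprNn.
have F'E c : 0 <= c -> (1 + c)^-1 - p^`().[c] = (- c) ^+ N / (1 + c).
  move=> c0; have c1 : 1 + c != 0 by rewrite gt_eqF// ltr_pwDl.
  by rewrite -[p^`().[c]](mulKf c1) dp; field.
have dF (x : R) : 0 <= x -> is_derive x 1 (fun x => ln (1 + x) - p.[x]) ((1 + x)^-1 - p^`().[x]).
  move=> x0; have x1 : 0 < 1 + x by rewrite ltr_pwDl.
  have dl := is_derive1_ln x1.
  have dpx := is_derive_poly p x.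
  apply: is_deriveB.
  rewrite -[(1 + x)^-1]mulr1.
  apply: (@is_derive1_comp _ (@ln R) (fun x => 1 + x)).
  rewrite (_ : (fun x => 1 + x) = shift (1 : R)); first exact: is_derive_shift.
  by apply/funext => y; rewrite /= addrC.
(* The remainder vanishes at 0, so it equals [t] times its derivative at some [c] in [(0, t)], which
   is at most [t^N] in absolute value. *)
have [x|//|c] := @MVT_segment _ (fun x => ln (1 + x) - p.[x]) (fun x => (1 + x)^-1 - p^`().[x]) 0 t t0.
- by rewrite in_itv/= => /andP[/ltW x0 _]; exact: dF.
- apply: derivable_within_continuous => x; rewrite in_itv/= => /andP[x0 _].
  by have := dF x x0; case.
rewrite in_itv/= subr0 => /andP[c0 ct].
have p0 : p.[0] = 0 by rewrite horner_coef0 coef_poly/= invr0 mulr0.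
rewrite addr0 ln1 p0 !subr0 => ->; rewrite F'E// normrM exprSr (ger0_norm t0).
rewrite ler_wpM2r// normrM normfV (@ger0_norm _ (1 + c)) ?addr_ge0//.
rewrite ler_pdivrMr ?ltr_pwDl// normrX normrN (ger0_norm c0).
rewrite (@le_trans _ _ (t ^+ N))// ?lerXn2r//.
by rewrite ler_peMr ?exprn_ge0// lerDl.
Qed.

Lemma expands_ln1p (R : realType) N :
  expands N.+1 (fun n => ln (1 + n%:R^-1) : R)
    (\poly_(i < N.+1) ((-1) ^+ i.-1 / i%:R)).
Proof.
by exists 1; near=> n; rewrite mul1r ln_remainder.
Unshelve. all: by end_near. Qed.

(* The second factor truncates the binomial series of [(1 + u) ^- k.+1], as
   [1 / (n+1) = u / (1 + u)] for [u = 1/n]. *)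
Lemma expands_invS_pow (R : realType) N k :
  expands N (fun n => n.+1%:R^-1 ^+ k.+1 : R)
    ('X^(k.+1) * \poly_(j < N) ((-1) ^+ j * 'C(k + j, j)%:R)).
Proof.
(* Division by [1 + u] is checked by multiplying back: [(1 + 'X) * q] has to agree with [p] below
   [N]. In the induction on the exponent this is Pascal's rule. *)
have step f (p q : {poly R}) : expands N f p ->
    (forall i, (i < N)%N -> ((1 + 'X) * q)`_i = p`_i) ->
    expands N (fun n => f n / (1 + n%:R^-1)) q.
  move=> fp pq; have := decaysD fp (decaysN (expands_poly pq)).
  move=> /decaysM - /(_ 0%N (fun n => (1 + n%:R^-1)^-1)); rewrite addn0 => h.
  apply: decays_eq (h _); last first.
    exists 1; near=> n; rewrite mul1r expr0 ger0_norm ?invr_ge0 ?addr_ge0//.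
    by rewrite invf_le1 ?ltr_pwDl// lerDl.
  near=> n; rewrite hornerM hornerD hornerX hornerC.
  have : 1 + n%:R^-1 != 0 :> R by rewrite gt_eqF// ltr_pwDl.
  by move: (n%:R^-1 : R) (f n) => u y u1; field.
have pow : expands N (fun n => ((1 + n%:R^-1)^-1) ^+ k.+1 : R)
    (\poly_(j < N) ((-1) ^+ j * 'C(k + j, j)%:R)).
  elim: k => [|k IH].
    apply: (expands_eq (f := fun n => 1 / (1 + n%:R^-1))).
      by near=> n; rewrite expr1 div1r.
    apply: (step (fun=> 1) 1).
      by apply: decays_eq (decays0 R _); near=> n; rewrite hornerC subrr.
    move=> i iN; rewrite mulrDl mul1r coefD coefXM coef1 !coef_poly iN add0n binn.
    case: i iN => [|i] iN; first by rewrite !mulr1 addr0.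
    by rewrite /= ltnW// add0n binn exprS; ring.
  apply: (expands_eq (f := fun n => (1 + n%:R^-1)^-1 ^+ k.+1 / (1 + n%:R^-1))).
    by near=> n; rewrite [RHS]exprSr.
  apply: step IH _ => i iN; rewrite mulrDl mul1r coefD coefXM !coef_poly iN.
  case: i iN => [|i] iN; first by rewrite !bin0 addr0.
  rewrite /= ltnW// addSn addnS binS natrD exprS addSn; ring.
have pX : expands N (fun n => n%:R^-1 ^+ k.+1 : R) 'X^(k.+1).
  by apply: decays_eq (decays0 R N); near=> n; rewrite hornerXn subrr.
apply: expands_eq (expandsM pX pow); near=> n.
have n0 : 0 < n%:R :> R by rewrite ltr0n; near: n; exact: nbhs_infty_gt.
rewrite -exprMn; congr (_ ^+ _); rewrite -natr1; field.
by rewrite !gt_eqF// ltr_pwDr.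
Unshelve. all: by end_near. Qed.

(** Follows from [bernoulli_sum] by splitting off the term [B 0 = 1] and using
    [(k+1) C(m+1,k+1) = (m+1) C(m,k)]. *)
Lemma bernoulli_moment_sum (R : realType) (B : nat -> R) m :
  bernoulli_numbers B ->
  \sum_(k < m) (-1) ^+ k * 'C(m, k)%:R * bernoulli_moment B k = - (m%:R / m.+1%:R).
Proof.
move=> hB; have B0 : B 0%N = 1.
  have := bernoulli_sum 0 hB.
  by rewrite big_ord_recl big_ord0 expr0 bin0 !mul1r addr0.
have := bernoulli_sum m hB; rewrite big_ord_recl/= expr0 bin0 B0 !mul1r.
rewrite -[in RHS]natr1 addrC => /addIr h.
have m1 k : k.+1%:R != 0 :> R by rewrite pnatr_eq0.
apply: (mulIf (m1 m)); rewrite mulNr mulfVK// -[in RHS]h.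
rewrite mulr_suml -sumrN; apply: eq_bigr => k _.
rewrite /bump/= add1n exprS.
have /(congr1 (fun n => n%:R : R)) := mul_bin_diag m.+1 k.
rewrite !natrM /= => binE.
rewrite /bernoulli_moment.
have -> : (-1) ^+ k * 'C(m, k)%:R * (B k.+1 / k.+1%:R) * m.+1%:R
  = (-1) ^+ k * (m.+1%:R * 'C(m, k)%:R) * B k.+1 / k.+1%:R :> R by ring.
by rewrite binE; field.
Qed.

Lemma expands_decays (R : realType) N f (p : {poly R}) :
  expands N f p -> (forall i, (i < N)%N -> p`_i = 0) -> decays N f.
Proof.
move=> fp p0; apply: decays_eq (decaysD fp (poly_decays p0)).
by near=> n; rewrite subrK.
Unshelve. all: by end_near. Qed.

Lemma expandsZ (R : realType) N c f (p : {poly R}) :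
  expands N f p -> expands N (fun n => c * f n) (c *: p).
Proof.
move=> fp; apply: decays_eq (decays_leq _ (decaysM (decays_cst c) fp)).
  by near=> n; rewrite hornerZ; ring.
by [].
Unshelve. all: by end_near. Qed.

Lemma expands_sum (R : realType) N m (f : nat -> nat -> R) (p : nat -> {poly R}) :
  (forall k, expands N (f k) (p k)) ->
  expands N (fun n => \sum_(k < m) f k n) (\sum_(k < m) p k).
Proof.
move=> fp; elim: m => [|m IH].
  by apply: decays_eq (decays0 R N); near=> n; rewrite !big_ord0 horner0 subrr.
rewrite big_ord_recr; apply: expands_eq (expandsD IH (fp m)).
by near=> n; rewrite big_ord_recr.
Unshelve. all: by end_near. Qed.

(** By telescoping it suffices to expand the difference of the remainder at [n] and [n+1]. Its
    coefficient of index [m+1] is, up to sign, [1/(m+1) - 1 + m/(m+1) = 0]: the logarithm, the term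
    [1/(n+1)] and [bernoulli_moment_sum] contribute in this order. *)
Lemma expands_harmonic (R : realType) (B : nat -> R) (c : R) N :
  bernoulli_numbers B ->
  (fun n => harmonic_number R n - ln n%:R - c) @ \oo --> (0 : R) ->
  expands N.+1 (fun n => harmonic_number R n - ln n%:R - c)
    (- ('X * \poly_(i < N) bernoulli_moment B i)).
Proof.
move=> hB f0; set f := fun n => _ - c; set mu := bernoulli_moment B.
have hornerS x : (- ('X * \poly_(i < N) mu i)).[x] = - \sum_(k < N) mu k * x ^+ k.+1.
  rewrite hornerN hornerM hornerX horner_poly mulr_sumr; congr (- _).
  by apply: eq_bigr => i _; rewrite exprS mulrCA.
apply: decays_telescope; last first.
  rewrite -[X in _ --> X](subrr 0); apply: cvgB f0 _; apply: (@decays_cvg0 _ 0).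
  apply: poly_decays => -[|//] _.
  by rewrite coefN coefXM oppr0.
(* Order [N.+2] makes up for the order lost in telescoping. *)
have binom := @expands_invS_pow R N.+2.
have upow k : expands N.+2 (fun n => n%:R^-1 ^+ k : R) 'X^k.
  by apply: decays_eq (decays0 R _); near=> n; rewrite hornerXn subrr.
have diffs := expands_sum N (fun k =>
  expandsZ (mu k) (expandsD (upow k.+1) (expandsN (binom k)))).
have all := expandsD (expandsD (expands_ln1p R N.+1) (expandsN (binom 0%N))) diffs.
apply: decays_eq (expands_decays all _).
  near=> n; rewrite !hornerS /f /harmonic_number.
  have n0 : (0 < n)%N by near: n; exact: nbhs_infty_gt.
  have -> : 1 + n%:R^-1 = n.+1%:R / n%:R :> R.
    by rewrite -natr1 mulrDl divff ?mul1r// pnatr_eq0 -lt0n.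
  rewrite ln_div ?posrE ?ltr0n// (big_nat_recr n.+1)//= expr1.
  rewrite (eq_bigr (fun k : 'I_N => mu k * n%:R^-1 ^+ k.+1 - mu k * n.+1%:R^-1 ^+ k.+1)).
    by rewrite sumrB; ring.
  by move=> k _; rewrite mulrBr.
move=> [|m] mN.
  rewrite !coefD !coefN coefXnM/= coef_poly/= invr0 mulr0 subr0 add0r coef_sum.
  rewrite big1// => k _.
  by rewrite coefZ coefD coefN coefXnM coefXn/= subr0 mulr0.
rewrite !coefD !coefN coefXnM/= coef_poly mN/= subn1/= coef_poly ltnW//.
rewrite add0n binn mulr1 coef_sum.
have mN' : (m <= N)%N by [].
(* Only [k < m] contributes: for [k = m] the powers of [1/n] and [1/(n+1)] have the same leading
   coefficient, and for [k > m] both start beyond index [m+1]. *)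
rewrite (eq_bigr (fun k : 'I_N => if (k < m)%N then
    (-1) ^+ m.+1 * ((-1) ^+ k * 'C(m, k)%:R * mu k) else 0)); last first.
  move=> k _; rewrite coefZ coefB coefXnM coefXn eqSS ltnS subSS.
  have [mk|mk|mk] := ltngtP (k : nat) m; last 2 first.
  - by rewrite subrr mulr0.
  - by rewrite mk subnn coef_poly expr0 addn0 bin0 mulr1 subrr mulr0.
  have mkN : (m - k < N.+2)%N by rewrite ltnS (leq_trans (leq_subr _ _))// leqW.
  rewrite coef_poly mkN (subnKC (ltnW mk)) (bin_sub (ltnW mk)).
  have -> : (-1) ^+ (m - k) = (-1) ^+ m * (-1) ^+ k :> R.
    by rewrite -{2}(subnK (ltnW mk)) exprD -mulrA -expr2 sqrr_sign mulr1.
  by rewrite exprS /=; ring.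
rewrite -big_mkcond/= -(big_ord_widen _ (fun k => (-1) ^+ m.+1 * ((-1) ^+ k * 'C(m, k)%:R * mu k)) mN').
rewrite -mulr_sumr bernoulli_moment_sum// exprS -(natr1 m).
by field; rewrite natr1 pnatr_eq0.
Unshelve. all: by end_near. Qed.

(** * Orthogonal polynomials *)

Lemma moment_functional_wide (R : realType) (mu : nat -> R) n (p : {poly R}) :
  (size p <= n)%N -> moment_functional mu p = \sum_(i < n) p`_i * mu i.
Proof.
move=> pn; rewrite /moment_functional (big_ord_widen n (fun i => p`_i * mu i))//.
rewrite big_mkcond/=; apply: eq_bigr => i _; case: ltnP => // pi.
by rewrite nth_default ?mul0r.
Qed.

Lemma moment_functionalD (R : realType) (mu : nat -> R) (p q : {poly R}) :
  moment_functional mu (p + q) = moment_functional mu p + moment_functional mu q.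
Proof.
have pq := size_polyD p q; rewrite !(@moment_functional_wide _ _ (maxn (size p) (size q)))//.
- by rewrite -big_split/=; apply: eq_bigr => i _; rewrite coefD mulrDl.
- exact: leq_maxr.
- exact: leq_maxl.
Qed.

Lemma moment_functionalZ (R : realType) (mu : nat -> R) c (p : {poly R}) :
  moment_functional mu (c *: p) = c * moment_functional mu p.
Proof.
rewrite !(@moment_functional_wide _ _ (size p))// ?size_scale_leq// mulr_sumr.
by apply: eq_bigr => i _; rewrite coefZ mulrA.
Qed.

Lemma moment_functional0 (R : realType) (mu : nat -> R) : moment_functional mu 0 = 0.
Proof. by rewrite -(scale0r 0) moment_functionalZ mul0r. Qed.

Lemma size_sub_monic (R : nzRingType) n (p q : {poly R}) :
  q \is monic -> size q = n.+1 -> (size p <= n.+1)%N -> (size (p - p`_n *: q)%R <= n)%N.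
Proof.
move=> /monicP; rewrite lead_coefE => + qn; rewrite qn/= => q1 pn.
apply/leq_sizeP => j; rewrite leq_eqVlt => /predU1P[<-|nj].
  by rewrite coefB coefZ q1 mulr1 subrr.
have pj : p`_j = 0 by rewrite nth_default// (leq_trans pn).
have qj : q`_j = 0 by rewrite nth_default// qn.
by rewrite coefB coefZ pj qj mulr0 subrr.
Qed.

(** Descent on the size: subtracting the multiple of [P m] that cancels the top coefficient does not
    change the pairing with [P k], as [m < k]. *)
Lemma orthogonal_lower (R : realType) (mu : nat -> R) P k m (p : {poly R}) :
  monic_orthogonal mu P -> (m <= k)%N -> (size p <= m)%N ->
  moment_functional mu (p * P k) = 0.
Proof.
move=> [Pm Po _]; elim: m p => [|m IH] p mk pm.
  by move: pm; rewrite leqn0 size_poly_eq0 => /eqP ->; rewrite mul0r moment_functional0.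
have [Pmonic Psize] := Pm m.
rewrite -[p](subrK (p`_m *: P m)) mulrDl -scalerAl moment_functionalD moment_functionalZ.
rewrite Po ?mulr0 ?addr0; last by apply/eqP; rewrite ltn_eqF.
by apply: IH; [exact: ltnW|exact: size_sub_monic].
Qed.

(** If [D = q - P k] were nonzero of degree [d], then [d < k], so [D] would be orthogonal to [P d];
    but the pairing of [D] with [P d] is the leading coefficient of [D] times the nonzero value at
    [P d ^+ 2]. *)
Lemma monic_orthogonal_unique (R : realType) (mu : nat -> R) P k (q : {poly R}) :
  monic_orthogonal mu P -> q \is monic -> size q = k.+1 ->
  (forall l, (l < k)%N -> moment_functional mu ('X^l * q) = 0) -> q = P k.
Proof.
move=> hP qm qk qX; have [Pm _ Pn] := hP; have [Pkm Pkk] := Pm k.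
have qlow (p : {poly R}) : (size p <= k)%N -> moment_functional mu (p * q) = 0.
  move=> pk; rewrite -[p]coefK poly_def mulr_suml.
  apply: (big_ind (fun r => moment_functional mu r = 0)) => [|r s r0 s0|i _].
  - exact: moment_functional0.
  - by rewrite moment_functionalD r0 s0 addr0.
  - by rewrite -scalerAl moment_functionalZ qX ?mulr0// (leq_trans _ pk).
apply/eqP; rewrite -subr_eq0; set D := q - P k; apply/negPn/negP => D0.
have Dk : (size D <= k)%N.
  have := size_sub_monic (p := q) Pkm Pkk; rewrite qk => /(_ (leqnn _)).
  by move/monicP: qm; rewrite lead_coefE qk/= => ->; rewrite scale1r.
have DE : size D = (size D).-1.+1 by rewrite prednK// size_poly_gt0.
set d := (size D).-1 in DE; have [Pdm Pdd] := Pm d.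
have Pdk : (size (P d) <= k)%N by rewrite Pdd -DE.
have : moment_functional mu (P d * D) = 0.
  rewrite mulrBr moment_functionalD -scaleN1r moment_functionalZ.
  by rewrite qlow// (orthogonal_lower hP (leqnn k))// mulr0 addr0.
rewrite mulrC -[D](subrK (D`_d *: P d)) mulrDl -scalerAl -expr2.
rewrite moment_functionalD moment_functionalZ (orthogonal_lower hP (leqnn d)); last first.
  by apply: size_sub_monic; rewrite // -DE.
rewrite add0r => /eqP; rewrite mulf_eq0 (negPf (Pn d)) orbF.
by rewrite /d -lead_coefE lead_coef_eq0 (negPf D0).
Qed.

(** * Continued fractions *)

(* The pair of polynomials with indices [k.-1] and [k] in the three-term
   recurrence started from [rs]; [(1, 0)] yields the numerators and [(0, 1)] the
   denominators of the approximants. *)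
Fixpoint cf_pair (R : realType) (a b : nat -> R) (rs : {poly R} * {poly R}) k :=
  if k is k'.+1 then
    let p := cf_pair a b rs k' in
    (p.2, ('X + (b k)%:P) * p.2 + a k *: p.1)
  else rs.

Definition cf_num (R : realType) (a b : nat -> R) k := (cf_pair a b (1, 0) k).2.
Definition cf_den (R : realType) (a b : nat -> R) k := (cf_pair a b (0, 1) k).2.

Lemma cf_denS (R : realType) (a b : nat -> R) k : (0 < k)%N ->
  cf_den a b k.+1 = ('X + (b k.+1)%:P) * cf_den a b k + a k.+1 *: cf_den a b k.-1.
Proof.
by case: k.
Qed.

Lemma size_cf_num (R : realType) (a b : nat -> R) k : (size (cf_num a b k) <= k)%N.
Proof.
suff [] : (size (cf_pair a b (1%R, 0%R) k).1 <= k.+1)%N /\ (size (cf_num a b k) <= k)%N by [].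
rewrite /cf_num; elim: k => [|k [IH1 IH2]]; first by rewrite size_poly1 size_poly0.
rewrite /=; case: cf_pair IH1 IH2 => r s /= r1 s1; split; first by rewrite (leq_trans s1) ?leqW.
apply: leq_trans (size_polyD _ _) _; rewrite geq_max (leq_trans (size_scale_leq _ _))// andbT.
by apply: leq_trans (size_polyMleq _ _) _; rewrite size_XaddC.
Qed.

Lemma cf_den_monic (R : realType) (a b : nat -> R) k :
  cf_den a b k \is monic /\ size (cf_den a b k) = k.+1.
Proof.
(* The recurrence reaches two steps back, so the induction must also bound the first component. *)
suff [] : (size (cf_pair a b (0%R, 1%R) k).1 <= k)%N /\
  cf_den a b k \is monic /\ size (cf_den a b k) = k.+1 by [].
rewrite /cf_den; elim: k => [|k [IH1 [IH2 IH3]]].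
  by rewrite size_poly0 size_poly1 monic1.
rewrite /=; case: cf_pair IH1 IH2 IH3 => r s /= r1 s1 s2; rewrite s2 leqnn; split=> //.
have sM : size (('X + (b k.+1)%:P) * s) = k.+2.
  by rewrite size_monicM ?monicXaddC ?size_XaddC ?s2// -size_poly_gt0 s2.
have lt : (size (a k.+1 *: r)%R < size (('X + (b k.+1)%:P) * s)%R)%N.
  by rewrite sM ltnS (leq_trans (size_scale_leq _ _)) ?leqW// (leq_trans r1).
by rewrite size_polyDl// sM monicE lead_coefDl// -monicE monicMr ?monicXaddC.
Qed.

(** Keeps the tails away from 0 for large [n], so that the divisions are genuine. Once the next tail
    is at least 1, its contribution is bounded by [|a j.+1|]. *)
Lemma U_tail_ge (R : realType) (a b : nat -> R) d j :
  \forall n \near \oo, n%:R / 2 <= U_tail a b n%:R d j.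
Proof.
elim: d j => [|d IH] j /=; near=> n.
  have : - (b j) * 2 <= n%:R by near: n; exact: nbhs_infty_ger.
  lra.
have : (`|b j| + `|a j.+1|) * 2 <= n%:R by near: n; exact: nbhs_infty_ger.
have : n%:R / 2 <= U_tail a b n%:R d j.+1 by near: n; exact: IH.
have : 2 <= n%:R :> R by near: n; exact: nbhs_infty_ger.
set U := U_tail _ _ _ _ _ => n2 nU; have U1 : 1 <= U by lra.
have : `|a j.+1 / U| <= `|a j.+1|.
  have U0 : 0 < U by lra.
  by rewrite normrM normfV (gtr0_norm U0) ler_pdivrMr// ler_peMr.
have := ler_norm (- b j); have := ler_norm (- (a j.+1 / U)); rewrite !normrN.
lra.
Unshelve. all: by end_near. Qed.

Lemma MC_decays (R : realType) (a b : nat -> R) k : decays 1 (MC a b k).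
Proof.
exists (2 * `|a 1%N|); near=> n.
have : n%:R / 2 <= U_den a b k 1 n by near: n; exact: U_tail_ge.
have : 0 < n%:R :> R by rewrite ltr0n; near: n; exact: nbhs_infty_gt.
rewrite /MC; move: (U_den _ _ _ _ _) => U n0 nU; have U0 : 0 < U by lra.
rewrite normrM normfV (gtr0_norm U0) expr1 mulrC mulrAC.
rewrite ler_wpM2r// -[2]invrK -invfM lef_pV2 ?posrE ?mulr_gt0//; lra.
Unshelve. all: by end_near. Qed.

(* Wallis' recurrence, proved with the not yet unfolded tail [U_den a b k j.+1 n]
   as the last partial denominator, so that no [cf_den] has to be nonzero. *)
Lemma MC_cf (R : realType) (a b : nat -> R) k : (0 < k)%N ->
  \forall n \near \oo, MC a b k n * (cf_den a b k).[n%:R] = (cf_num a b k).[n%:R].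
Proof.
move=> k0.
have U0 j : \forall n \near \oo, U_den a b k j n != 0.
  near=> n; have n0 : 0 < n%:R :> R by rewrite ltr0n; near: n; exact: nbhs_infty_gt.
  rewrite gt_eqF//; apply: (@lt_le_trans _ _ (n%:R / 2)); first by rewrite divr_gt0.
  by near: n; exact: U_tail_ge.
pose tail rs j n : R :=
  U_den a b k j.+1 n * (cf_pair a b rs j).2.[n%:R] + a j.+1 * (cf_pair a b rs j).1.[n%:R].
have tailS rs j n : (j.+1 < k)%N -> U_den a b k j.+2 n != 0 ->
    tail rs j n * U_den a b k j.+2 n = tail rs j.+1 n.
  move=> jk U1; rewrite /tail/= !hornerE.
  have -> : U_den a b k j.+1 n = n%:R + b j.+1 + a j.+2 / U_den a b k j.+2 n.
    by rewrite /U_den -[in LHS](subnSK jk).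
  by field.
have wallis j : (j < k)%N -> \forall n \near \oo,
    MC a b k n * tail (0, 1) j n = tail (1, 0) j n.
  elim: j => [_|j IH jk]; near=> n.
    rewrite /tail/= !hornerC !mulr0 !mulr1 addr0 add0r /MC divfK//.
    by near: n.
  have U1 : U_den a b k j.+2 n != 0 by near: n; exact: U0.
  rewrite -!tailS// mulrA; congr (_ * _).
  by near: n; exact: IH (ltnW jk).
case: k k0 U0 @tail tailS wallis => // k _ U0 tail tailS wallis.
near=> n; have : MC a b k.+1 n * tail (0, 1) k n = tail (1, 0) k n.
  by near: n; exact: wallis.
(* The innermost tail has no further level, so [tail] at [k] is the next step of [cf_pair]. *)
have UE : U_den a b k.+1 k.+1 n = n%:R + b k.+1 by rewrite /U_den subnn.
by rewrite /tail /cf_den /cf_num /= !hornerE UE.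
Unshelve. all: by end_near. Qed.

(** * From Cao's condition to orthogonality *)

Lemma cvg_decays (R : realType) N (f : nat -> R) (l : R) :
  (fun n => n%:R ^+ N * f n) @ \oo --> l -> decays N f.
Proof.
move=> /cvgrPdist_le /(_ 1 ltr01) fl; exists (`|l| + 1); near=> n.
have n0 : 0 < n%:R :> R by rewrite ltr0n; near: n; exact: nbhs_infty_gt.
rewrite exprVn ler_pdivlMr ?exprn_gt0// -[X in _ * X]ger0_norm ?exprn_ge0//.
rewrite -normrM mulrC -lerBlDl (le_trans (lerB_dist _ _))// distrC.
by near: n.
Unshelve. all: by end_near. Qed.

(** Turns polynomials in [n] into polynomials in [1/n]. The reversal is taken with respect to the
    fixed degree [k], so numerators of lower degree share the factor [n^-k] with the denominator. *)
Lemma horner_rev (R : realType) (p : {poly R}) k (x : R) :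
  x != 0 -> (size p <= k.+1)%N ->
  (\poly_(i < k.+1) p`_(k - i)).[x^-1] = x^-1 ^+ k * p.[x].
Proof.
move=> x0 pk; rewrite horner_poly (horner_coef_wide x pk) mulr_sumr.
rewrite (reindex_inj rev_ord_inj); apply: eq_bigr => i _ /=.
have ik : (i <= k)%N by rewrite -ltnS.
have -> : x^-1 ^+ k = x^-1 ^+ (k - i) * x^-1 ^+ i by rewrite -exprD subnK.
rewrite subSS subKn// !exprVn; field.
by rewrite !expf_neq0.
Qed.

(** Multiplying the error by the denominator and by [n^-k] leaves [O(n^-(2k+1))], so all
    coefficients up to index [2k] cancel. The reversed numerator has degree at most [k], so indices
    [k+1] to [2k] give the [k] orthogonality relations. Index 1 gives the second claim, which for
    [k = 1] determines [a 1]. *)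
Lemma cf_den_moment (R : realType) (B a b : nat -> R) k :
  bernoulli_numbers B -> cao_sequences a b -> (0 < k)%N ->
  (forall l, (l < k)%N ->
    moment_functional (bernoulli_moment B) ('X^l * cf_den a b k) = 0) /\
  (cf_num a b k)`_k.-1 = - bernoulli_moment B 0.
Proof.
move=> hB hab k0; set mu := bernoulli_moment B.
have E m : (0 < m)%N -> decays (2 * m + 1) (approx_error a b m).
  by move=> /hab[c [+ _]]; exact: cvg_decays.
pose f n : R := harmonic_number R n - ln n%:R - euler_gamma R.
(* The limit is read off from Cao's condition for [k = 1], as [MC a b 1] itself tends to 0. *)
have f0 : f @ \oo --> (0 : R).
  apply: (@decays_cvg0 _ 0).
  apply: decays_eq (decaysD (decays_leq _ (E 1%N isT)) (MC_decays a b 1)) => //.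
  by near=> n; rewrite /approx_error subrK.
have [Qmonic Qsize] := cf_den_monic a b k.
set Q := cf_den a b k in Qmonic Qsize *.
pose rv (p : {poly R}) := \poly_(i < k.+1) p`_(k - i).
have rvexp p N : expands N (fun n => (rv p).[n%:R^-1]) (rv p) by exact: expands_poly.
have fexp := expands_harmonic (2 * k) hB f0.
have Psize : (size (cf_num a b k) <= k.+1)%N by rewrite leqW// size_cf_num.
have pexp := expandsD (expandsM (rvexp Q _) fexp) (expandsN (rvexp (cf_num a b k) _)).
have z : expands (2 * k).+1
    (fun n => (rv Q).[n%:R^-1] * f n - (rv (cf_num a b k)).[n%:R^-1]) 0.
  have := decaysM (decays_poly (rv Q)) (E k k0); rewrite add0n addn1 => d.
  apply: decays_eq d; near=> n.
  have n0 : n%:R != 0 :> R.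
    by rewrite pnatr_eq0 -lt0n; near: n; exact: nbhs_infty_gt.
  rewrite horner0 subr0 !horner_rev// ?Qsize//.
  have <- : MC a b k n * Q.[n%:R] = (cf_num a b k).[n%:R].
    by near: n; exact: MC_cf.
  by rewrite /approx_error -/(f n); ring.
(* The factor ['X] in the expansion of [f] shifts the index by one. *)
have rvE i : (i < 2 * k)%N ->
    (rv (cf_num a b k))`_i.+1 = - \sum_(j < i.+1) (rv Q)`_j * mu (i - j)%N.
  move=> ik; have := expands_uniq pexp z (i := i.+1) ik.
  rewrite coef0 coefB mulrN coefN mulrCA coefXM/= => /eqP.
  rewrite -opprD oppr_eq0 addrC addr_eq0 => /eqP ->; rewrite coefM; congr (- _).
  apply: eq_bigr => j _; rewrite [X in _ * X]coef_poly.
  by rewrite (leq_ltn_trans (leq_subr _ _) ik).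
split=> [l lk|].
  have klk : (k + l < 2 * k)%N by rewrite mul2n -addnn ltn_add2l.
  have QM : \sum_(j < k.+1 + l) (rv Q)`_j * mu (k + l - j)%N = 0.
    apply/eqP; rewrite -oppr_eq0 -(rvE _ klk); apply/eqP.
    by rewrite nth_default// (leq_trans (size_poly _ _))// ltnS leq_addr.
  rewrite (@moment_functional_wide _ _ (l + k.+1)); last first.
    by rewrite -Qsize size_monicM ?monicXn ?size_polyXn// -size_poly_gt0 Qsize.
  (* Both sums have [k.+1 + l] terms: multiplication by ['X^l] puts [l] zeros in front, reversal
     puts them at the end. The remaining terms match in reverse order. *)
  rewrite big_split_ord/= big1 ?add0r => [|i _]; last by rewrite coefXnM ltn_ord mul0r.
  rewrite -[RHS]QM big_split_ord/= [X in _ = _ + X]big1 ?addr0 => [|i _]; last first.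
    by rewrite coef_poly ltnNge leq_addr mul0r.
  rewrite (reindex_inj rev_ord_inj); apply: eq_bigr => i _ /=.
  have ik : (i <= k)%N by rewrite -ltnS.
  rewrite coefXnM ltnNge leq_addr/= addKn coef_poly ltn_ord subSS.
  by rewrite addnBA// addnC.
have := rvE 0%N; rewrite big_ord1 muln_gt0 => /(_ k0).
rewrite !coef_poly subn0 subnn ltnS k0 subn1 => ->.
by move/monicP: Qmonic; rewrite lead_coefE Qsize/= => ->; rewrite mul1r.
Unshelve. all: by end_near. Qed.

(** * Denominator tails and the theorem *)

Lemma U_tailE (R : realType) (alpha beta : nat -> R) (x : R) d j : x != 0 ->
  U_tail alpha beta x d j = x * V_tail alpha beta x d j.
Proof.
move=> x0; elim: d j => [|d IH] j /=; first by field.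
(* The inverse is generalized to [w], so the identity also covers a vanishing tail, where [w] is
   0. *)
rewrite IH expr2 -mulrA [in RHS]invfM; move: (_ * V_tail _ _ _ _ _)^-1 => w.
by field.
Qed.

Lemma U_tail_eq (R : realType) (a b alpha beta : nat -> R) (x : R) d j :
  (forall i, (0 < i)%N -> a i = alpha i /\ b i = beta i) -> (0 < j)%N ->
  U_tail a b x d j = U_tail alpha beta x d j.
Proof.
move=> e; elim: d j => [|d IH] j j0 /=; have [_ ->//] := e j j0.
by have [->] := e j.+1 isT; rewrite IH.
Qed.

Unset Implicit Arguments.

Theorem proposition20 (R : realType) (B a b alpha beta : nat -> R)
    (hB : bernoulli_numbers B)
    (hab : cao_sequences a b)
    (halpha_beta : recurrence_coefficients (bernoulli_moment B) alpha beta) :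
  (forall j : nat, (1 <= j)%N -> a j = alpha j /\ b j = beta j) /\
  (forall j k : nat, (1 <= j)%N -> (j <= k)%N ->
     (fun n : nat => U_den a b k j n - n%:R * V_den alpha beta k j n)
       =O_\oo (fun n : nat => n%:R ^- (2 * k - 2 * j + 1) : R)).
Proof.
have eqs j : (1 <= j)%N -> a j = alpha j /\ b j = beta j.
  case: halpha_beta => alpha1 [P [hP P0 P1 PS]].
  have QP k : cf_den a b k = P k.
    have [Qm Qs] := cf_den_monic a b k.
    case: k Qm Qs => [|k] Qm Qs; first by rewrite P0.
    apply: (monic_orthogonal_unique hP Qm Qs).
    by have [] := cf_den_moment hB hab (ltn0Sn k).
  case: j => [//|[_|j _]].
    split.
      rewrite alpha1; have [_ <-] := cf_den_moment hB hab (ltn0Sn 0).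
      by rewrite /cf_num/= mulr0 add0r coefZ coef1 mulr1.
    have := QP 1%N; rewrite P1 /cf_den/= mulr1 scaler0 addr0.
    by move=> /addrI /polyC_inj.
  (* Both recurrences now run over the same polynomials. In their difference the coefficient of
     index [j.+1] isolates [b] and [beta], and then that of index [j] isolates [a] and [alpha]. *)
  have := QP j.+2; rewrite PS// cf_denS// !QP/= => /eqP.
  rewrite !mulrDl -!addrA (inj_eq (addrI _)) !mul_polyC => /eqP h.
  have [[m1 s1] [m0 s0]] : (P j.+1 \is monic /\ size (P j.+1) = j.+2) /\
    (P j \is monic /\ size (P j) = j.+1) by case: hP.
  have c1 : (P j.+1)`_j.+1 = 1 by move/monicP: m1; rewrite lead_coefE s1.
  have c0 : (P j)`_j = 1 by move/monicP: m0; rewrite lead_coefE s0.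
  have z : (P j)`_j.+1 = 0 by rewrite nth_default ?s0.
  have bE : b j.+2 = beta j.+2.
    have := congr1 (fun p : {poly R} => p`_j.+1) h.
    by rewrite /= !coefD !coefZ c1 z !mulr1 !mulr0 !addr0.
  split=> //; move: h; rewrite bE => /addrI /(congr1 (fun p : {poly R} => p`_j)).
  by rewrite /= !coefZ c0 !mulr1.
(* The difference of the tails is exactly 0 for [n > 0], so any nonnegative constant works. *)
split=> // j k j0 jk; apply/eqOP; near=> C.
have C0 : 0 <= C by near: C; exact: nbhs_pinfty_ge.
near=> n.
have n0 : n%:R != 0 :> R by rewrite pnatr_eq0 -lt0n; near: n; exact: nbhs_infty_gt.
rewrite /U_den /V_den (U_tail_eq _ _ eqs j0) U_tailE// subrr normr0.
by rewrite mulr_ge0.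
Unshelve. all: by end_near. Qed.
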